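(* For $2\le k\le n$ and $\tau\in S_k^{\text{sep}}$, $$E_n^{\text{sep}}N_n^{(k;\tau)}=\frac{(n-k+1)\,|S_{n-k+1}^{\text{sep}}|}{|S_n^{\text{sep}}|},$$ and (for fixed $k$ and $\tau$) $$\lim_{n\to\infty}\frac{E_n^{\text{sep}}N_n^{(k;\tau)}}n=(3-2\sqrt2)^{k-1}.$$ Also, for $2\le k\le n$, $$E_n^{\text{sep}}N_n^{(k)}=\frac{(n-k+1)\,|S_{n-k+1}^{\text{sep}}|\,|S_k^{\text{sep}}|}{|S_n^{\text{sep}}|},$$ and (for fixed $k$) $$\lim_{n\to\infty}\frac{E_n^{\text{sep}}N_n^{(k)}}n=(3-2\sqrt2)^{k-1}|S_k^{\text{sep}}|.$$
   Context: $S_n$ is the set of permutations $\sigma=\sigma_1\cdots\sigma_n$ of $[n]=\{1,\dots,n\}$. A permutation $\sigma\in S_n$ contains $\eta\in S_m$ ($m\le n$) as a pattern if there are indices $1\le i_1<\cdots<i_m\le n$ such that for all $1\le j,k\le m$, $\sigma_{i_j}<\sigma_{i_k}$ if and only if $\eta_j<\eta_k$; otherwise $\sigma$ avoids $\eta$. A permutation is separable if it can be constructed from the singleton in $S_1$ by iterating direct sums and skew sums; equivalently, if it avoids both patterns $2413$ and $3142$. $S_n^{\text{sep}}$ is the set of separable permutations in $S_n$, $P_n^{\text{sep}}$ is the uniform probability measure on $S_n^{\text{sep}}$, and $E_n^{\text{sep}}$ is the corresponding expectation. For $2\le k\le n$, $\tau\in S_k^{\text{sep}}$ and $\sigma\in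 S_n^{\text{sep}}$, $N_n^{(k;\tau)}(\sigma)$ is the number of pairs $(l,m)$ with $1\le l,m\le n-k+1$ such that $\{l,\dots,l+k-1\}=\{\sigma_m,\dots,\sigma_{m+k-1}\}$ and $\tau_i=\sigma_{m+i-1}-(l-1)$ for $i=1,\dots,k$. $N_n^{(k)}(\sigma)$ is the number of pairs $(l,m)$ with $1\le l,m\le n-k+1$ and $\{l,\dots,l+k-1\}=\{\sigma_m,\dots,\sigma_{m+k-1}\}$. *)

(* Defs.v *)
From HB Require Import structures.
From mathcomp Require Import all_boot all_order all_algebra all_fingroup.
From mathcomp Require Import boolp.

Set Implicit Arguments.
Unset Strict Implicit.
Unset Printing Implicit Defensive.

Import GRing.Theory.

(* The word [:: sigma_1; ...; sigma_n] of sigma, with letters in {1, ..., n};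
   the positions and values of sigma : 'S_n itself are numbered from 0. *)
Definition one_line (n : nat) (sigma : 'S_n) : seq nat :=
  [seq (sigma i).+1 | i <- enum 'I_n].

Definition direct_sum (u v : seq nat) : seq nat :=
  u ++ [seq size u + x | x <- v].

Definition skew_sum (u v : seq nat) : seq nat :=
  [seq size v + x | x <- u] ++ v.

Inductive separable_word : seq nat -> Prop :=
| separable_singleton : separable_word [:: 1]
| separable_direct_sum (u v : seq nat) :
    separable_word u -> separable_word v -> separable_word (direct_sum u v)
| separable_skew_sum (u v : seq nat) :
    separable_word u -> separable_word v -> separable_word (skew_sum u v).

Definition separable (n : nat) (sigma : 'S_n) : Prop :=
  separable_word (one_line sigma).

Definition Ssep (n : nat) : {set 'S_n} := [set sigma | `[< separable sigma >]].

Definition Psep (R : realFieldType) (n : nat) (A : {set 'S_n}) : R :=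
  (#|A :&: Ssep n|%:R / #|Ssep n|%:R)%R.

Definition Esep (R : realFieldType) (n : nat) (X : 'S_n -> R) : R :=
  (\sum_(sigma : 'S_n) X sigma * Psep R [set sigma])%R.

(* {l, ..., l+k-1} = {sigma_m, ..., sigma_(m+k-1)}, with l and m (as well as
   positions and values) numbered from 0. *)
Definition is_block (k n : nat) (sigma : 'S_n) (l m : nat) : bool :=
  [set v : 'I_n | l <= v < l + k] == [set sigma i | i : 'I_n & m <= i < m + k].

(* With 0-based numbering, tau_i = sigma_(m+i-1) - (l-1) becomes
   tau i = sigma (m + i) - l. *)
Definition is_block_with_pattern (k n : nat) (tau : 'S_k) (sigma : 'S_n)
    (l m : nat) : bool :=
  is_block k sigma l m &&
  [forall i : 'I_k, forall j : 'I_n,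
     (j == m + i :> nat) ==> (tau i == sigma j - l :> nat)].

(* Counts of pairs (l, m) in {0, ..., n-k}^2; meaningful for k <= n only. *)
Definition Nblock (k n : nat) (sigma : 'S_n) : nat :=
  #|[set lm : 'I_(n - k).+1 * 'I_(n - k).+1 | is_block k sigma lm.1 lm.2]|.

Definition Nblock_pattern (k n : nat) (tau : 'S_k) (sigma : 'S_n) : nat :=
  #|[set lm : 'I_(n - k).+1 * 'I_(n - k).+1 |
      is_block_with_pattern tau sigma lm.1 lm.2]|.

(* Main.v *)
Require Import Defs.
From HB Require Import structures.
From mathcomp Require Import all_boot all_order all_algebra all_fingroup.
From mathcomp Require Import zify ring lra.
From mathcomp Require Import all_classical all_reals all_analysis.

Set Implicit Arguments.
Unset Strict Implicit.
Unset Printing Implicit Defensive.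

(** Collapsing a block of a permutation to a single letter leaves a permutation
    of size n - k + 1 with a marked letter; the position and the value of that
    letter are those of the block.  Conversely, inflating a marked letter by tau
    creates a block with pattern tau at the corresponding place.  For a fixed
    tau these two operations are inverse to each other, and both preserve
    separability when tau is separable: separable words are closed under taking
    patterns (contraction) and under substitution (inflation).  Hence the
    occurrences of tau as a block, over all separable permutations of size n,
    are as many as the letters of all separable permutations of size n - k + 1
    ([card_block_pattern], [sum_Nblock_pattern]).  The pattern of a block of a
    separable permutation is itself separable, so summing over tau multiplies
    the count by the number of separable permutations of size k ([sum_Nblock]).

    The limits need the ratio of consecutive numbers s_n of separable
    permutations.  A separable permutation of size at least 2 is either a direct
    or a skew sum, never both, and reversal exchanges the two cases; splitting a
    direct sum after its first indecomposable summand gives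
    s_n = s_(n-1) + sum_i s_i s_(n-i) ([card_Ssep_rec]), that is, the generating
    function S satisfies S^2 + (x - 1) S + x = 0.  Then W = 1 - x - 2 S is a
    square root of D = 1 - 6 x + x^2, so 2 D W' = D' W, which is the three-term
    recurrence (n + 1) s_(n+1) = (6 n - 3) s_n - (n - 2) s_(n-1)
    ([schroeder_three_term]).  The ratios r_n = s_(n+1) / s_n therefore satisfy
    r_n = 6 - 1 / r_(n-1) up to an error of order 1 / n.  The map
    r |-> 6 - 1 / r contracts towards its fixed point 3 + 2 sqrt 2, with factor
    at most 1/5 on the relevant range, and an induction shows that r_n is within
    48 / (n + 1) of the fixed point ([ratio_dist_le]).  A product of k - 1
    inverse ratios gives (3 - 2 sqrt 2)^(k - 1). *)

(** * Separability as a property of words up to order *)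

(** The flag treats direct sums ([true]) and skew sums ([false]) uniformly. *)
Definition ltn_dir (b : bool) (x y : nat) : bool := if b then x < y else y < x.

(** Separability that depends only on the relative order of the letters: no
    shift of values, hence no arithmetic, when words are cut, mapped or
    substituted.  [SsepP] relates it to separable permutations. *)
Inductive sepseq : seq nat -> Prop :=
| sepseq1 x : sepseq [:: x]
| sepseq_cat b u v : sepseq u -> sepseq v -> allrel (ltn_dir b) u v -> sepseq (u ++ v).

Lemma sepseq_size w : sepseq w -> 0 < size w.
Proof. by elim=> // b u v _ su _ _ _; rewrite size_cat ltn_addr. Qed.

Lemma sepseq_map f w :
  {in w &, {mono f : x y / x < y}} -> sepseq w -> sepseq (map f w).
Proof.
move=> fm sw; elim: sw fm => [x|b u v _ IHu _ IHv uv] fm; first exact: sepseq1.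
rewrite map_cat; apply: (@sepseq_cat b).
- by apply: IHu => x y xu yu; apply: fm; rewrite mem_cat (xu, yu).
- by apply: IHv => x y xu yu; apply: fm; rewrite mem_cat (xu, yu) orbT.
apply/allrelP => _ _ /mapP[x xu ->] /mapP[y yv ->].
have [xw yw] : x \in u ++ v /\ y \in u ++ v by rewrite !mem_cat xu yv orbT.
by have := allrelP uv _ _ xu yv; rewrite /ltn_dir; case: (b); rewrite fm.
Qed.

(** Closure under patterns: cutting a sum cuts each summand, and a summand which
    becomes empty drops out. *)
Lemma sepseq_subseq w t : sepseq w -> subseq t w -> 0 < size t -> sepseq t.
Proof.
move=> sw /subseqP[m szm ->]; elim: sw m szm => {w t}[x|b u v _ IHu _ IHv uv] m szm.
  by case: m szm => [|[] []]// _ _; apply: sepseq1.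
rewrite -(cat_take_drop (size u) m).
have szu : size (take (size u) m) = size u by rewrite size_takel// szm size_cat leq_addr.
have szv : size (drop (size u) m) = size v.
  by rewrite size_drop szm size_cat addKn.
rewrite mask_cat// size_cat.
case: (posnP (size (mask (take (size u) m) u))) => [/size0nil -> /=|u0 _].
  exact: IHv.
case: (posnP (size (mask (drop (size u) m) v))) => [/size0nil ->|v0].
  by rewrite cats0; apply: IHu.
apply: (@sepseq_cat b); [exact: IHu|exact: IHv|].
by apply/allrelP => x y /mem_mask xu /mem_mask yv; apply: (allrelP uv).
Qed.

Lemma sepseq_rev w : sepseq w -> sepseq (rev w).
Proof.
elim=> [x|b u v _ IHu _ IHv uv]; first exact: sepseq1.
rewrite rev_cat; apply: (@sepseq_cat (~~ b)) => //.
apply/allrelP => x y; rewrite !mem_rev => xv yu.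
by have := allrelP uv _ _ yu xv; rewrite /ltn_dir; case: (b).
Qed.

(** Closure under substitution of [t] for the letter [x]: the hypothesis says
    that the other letters see each letter of [t] where they saw [x], so the sum
    decomposition of [w] still applies after the substitution. *)
Lemma sepseq_inflate w x t : sepseq w -> sepseq t ->
  {in t & w, forall y z, z != x -> (y < z) = (x < z) /\ (z < y) = (z < x)} ->
  sepseq (flatten [seq if z == x then t else [:: z] | z <- w]).
Proof.
move=> sw st; elim: sw => [z|b u v su IHu sv IHv uv] cw /=.
  by case: eqP => _; rewrite cats0 //; apply: sepseq1.
rewrite map_cat flatten_cat; apply: (@sepseq_cat b).
- by apply: IHu => y z yt zu; apply: cw; rewrite ?mem_cat ?zu.
- by apply: IHv => y z yt zu; apply: cw; rewrite ?mem_cat ?zu ?orbT.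
apply/allrelP => y z /flattenP[_ /mapP[y' yu ->] yy] /flattenP[_ /mapP[z' zv ->] zz].
have := allrelP uv _ _ yu zv.
move: yy zz; case: eqP => [->|/eqP yx] yy; case: eqP => [->|/eqP zx] zz.
- by rewrite /ltn_dir; case: (b); rewrite ltnn.
- move: zz; rewrite inE => /eqP ->.
  have zw : z' \in u ++ v by rewrite mem_cat zv orbT.
  by have [e1 e2] := cw _ _ yy zw zx; rewrite /ltn_dir e1 e2.
- move: yy; rewrite inE => /eqP ->.
  have yw : y' \in u ++ v by rewrite mem_cat yu.
  by have [e1 e2] := cw _ _ zz yw yx; rewrite /ltn_dir e1 e2.
- by move: yy zz; rewrite !inE => /eqP -> /eqP ->.
Qed.

Lemma separable_word_sepseq w :
  separable_word w -> sepseq w /\ {in w, forall x, 0 < x <= size w}.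
Proof.
elim=> [|u v _ [su bu] _ [sv bv]|u v _ [su bu] _ [sv bv]].
- by split; [exact: sepseq1 | move=> x; rewrite inE => /eqP->].
- split.
    apply: (@sepseq_cat true) => //.
      by apply: sepseq_map sv => x y _ _; rewrite ltn_add2l.
    by apply/allrelP => x _ /bu xu /mapP[y /bv yv ->] /=; lia.
  move=> x; rewrite /direct_sum size_cat size_map mem_cat.
  by case/orP=> [/bu|/mapP[y /bv yv ->]]; lia.
- split.
    apply: (@sepseq_cat false) => //.
      by apply: sepseq_map su => x y _ _; rewrite ltn_add2l.
    by apply/allrelP => _ y /mapP[x /bu xu ->] /bv yv /=; lia.
  move=> x; rewrite /skew_sum size_cat size_map mem_cat.
  by case/orP=> [/mapP[y /bu yv ->]|/bv]; lia.
Qed.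

(** Standardization: each letter is replaced by its rank.  It recovers the values
    1, ..., n from the relative order alone. *)
Definition ranks (w : seq nat) : seq nat := [seq count (fun y => y <= x) w | x <- w].

Lemma sepseq_separable_word w : sepseq w -> separable_word (ranks w).
Proof.
elim=> [x|b u v _ IHu _ IHv /allrelP uv].
  by rewrite /ranks /= leqnn; apply: separable_singleton.
case: b uv => /= uv.
- suff -> : ranks (u ++ v) = direct_sum (ranks u) (ranks v) by apply: separable_direct_sum.
  rewrite /ranks map_cat /direct_sum size_map -map_comp; congr (_ ++ _); apply/eq_in_map.
    move=> x xu; rewrite count_cat [X in _ + X](_ : _ = 0) ?addn0//.
    by apply/eqP; rewrite -leqn0 leqNgt -has_count; apply/hasPn => y /(uv _ _ xu); lia.
  move=> x xv /=; rewrite count_cat [X in X + _](_ : _ = size u)//.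
  by apply/eqP; rewrite -all_count; apply/allP => y /uv/(_ xv); lia.
- suff -> : ranks (u ++ v) = skew_sum (ranks u) (ranks v) by apply: separable_skew_sum.
  rewrite /ranks map_cat /skew_sum size_map -map_comp; congr (_ ++ _); apply/eq_in_map.
    move=> x xu /=; rewrite count_cat addnC [X in X + _](_ : _ = size v)//.
    by apply/eqP; rewrite -all_count; apply/allP => y /(uv _ _ xu); lia.
  move=> x xv; rewrite count_cat [X in X + _](_ : _ = 0)//.
  by apply/eqP; rewrite -leqn0 leqNgt -has_count; apply/hasPn => y /uv/(_ xv); lia.
Qed.

Lemma ranks_perm n w : perm_eq w (iota 1 n) -> ranks w = w.
Proof.
move=> pw; rewrite -[RHS]map_id; apply/eq_in_map => x.
rewrite (perm_mem pw) mem_iota => xn.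
rewrite (seq.permP pw) -size_filter.
rewrite (_ : n = x + (n - x)) ?iotaD ?filter_cat; last lia.
rewrite (@eq_in_filter _ _ predT) ?filter_predT; last by move=> y; rewrite mem_iota /=; lia.
rewrite (@eq_in_filter _ _ pred0) ?filter_pred0 ?cats0 ?size_iota//.
by move=> y; rewrite mem_iota /=; lia.
Qed.

(** Permutations act on natural numbers, fixing those out of range: positions
    and values can then be shifted freely, and injectivity holds without
    side conditions. *)
Definition permnat n (s : 'S_n) (i : nat) : nat :=
  if insub i is Some j then val (s j) else i.

Lemma permnatE n (s : 'S_n) (i : 'I_n) : permnat s i = s i.
Proof. by rewrite /permnat valK. Qed.

Lemma permnat_lt n (s : 'S_n) i : (permnat s i < n) = (i < n).
Proof. by rewrite /permnat; case: insubP => [j -> _|/negbTE ->//]; rewrite ltn_ord. Qed.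

Lemma permnat_inj n (s : 'S_n) : injective (permnat s).
Proof.
move=> i j; have := permnat_lt s i; have := permnat_lt s j.
case: (ltnP i n) => ni; case: (ltnP j n) => nj; try lia.
  have /= -> := permnatE s (Ordinal ni); have /= -> := permnatE s (Ordinal nj).
  by move=> _ _ /val_inj/perm_inj [].
by rewrite /permnat !insubF ?(ltnNge i) ?(ltnNge j) ?ni ?nj.
Qed.

Lemma permnat_surj n (s : 'S_n) v : v < n -> exists2 i, i < n & permnat s i = v.
Proof.
move=> vn; exists ((s^-1)%g (Ordinal vn)); first exact: ltn_ord.
by rewrite permnatE permKV.
Qed.

Lemma permnat_ext n (s t : 'S_n) : (forall i, i < n -> permnat s i = permnat t i) -> s = t.
Proof.
by move=> e; apply/permP => i; apply/val_inj; rewrite /= -!permnatE e.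
Qed.

Definition mkperm n (f : nat -> nat) : 'S_n :=
  insubd (1%g : 'S_n) [ffun i : 'I_n => insubd i (f i)].

Lemma permnat_mkperm n f : (forall i, i < n -> f i < n) ->
  (forall i j, i < n -> j < n -> f i = f j -> i = j) ->
  forall i, i < n -> permnat (mkperm n f) i = f i.
Proof.
move=> fn fi i ni; have /= -> := permnatE (mkperm n f) (Ordinal ni); rewrite /mkperm.
have inj : injectiveb [ffun i : 'I_n => insubd i (f i)].
  apply/injectiveP => x y; rewrite !ffunE => /(congr1 val).
  by rewrite !val_insubd !fn// => /fi e; apply/val_inj/e.
by rewrite -pvalE insubdK//= ffunE val_insubd fn.
Qed.

(** [one_line] with letters numbered from 0 ([one_lineE]). *)
Definition word n (s : 'S_n) : seq nat := mkseq (permnat s) n.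

Lemma one_lineE n (s : 'S_n) : one_line s = map succn (word s).
Proof.
rewrite /one_line /word /mkseq -val_enum_ord -!map_comp.
by apply: eq_map => i /=; rewrite permnatE.
Qed.

Lemma perm_one_line n (s : 'S_n) : perm_eq (one_line s) (iota 1 n).
Proof.
apply: uniq_perm; rewrite ?iota_uniq//.
  by rewrite one_lineE map_inj_uniq ?mkseq_uniq//; [exact: permnat_inj|exact: succn_inj].
move=> x; rewrite mem_iota one_lineE; apply/mapP/idP => [[y /mapP[i]]|xn].
  by rewrite mem_iota => ni -> ->; have := permnat_lt s i; lia.
have [|i ni e] := @permnat_surj n s x.-1; first lia.
by exists x.-1; [rewrite -e map_f ?mem_iota | lia].
Qed.

Lemma SsepP n (s : 'S_n) : reflect (sepseq (word s)) (s \in Ssep n).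
Proof.
rewrite inE; rewrite /separable; apply: (iffP (asboolP _)) => [/separable_word_sepseq[]|].
  rewrite one_lineE => /(@sepseq_map predn) + _; rewrite -map_comp map_id; apply.
  by move=> _ _ /mapP[x _ ->] /mapP[y _ ->].
move=> sw; rewrite -(ranks_perm (perm_one_line s)); apply: sepseq_separable_word.
by rewrite one_lineE; apply: sepseq_map sw.
Qed.

(** * Inflation and contraction of blocks *)

Lemma sum_bool_card (T : finType) (A : {set T}) (P : pred T) :
  \sum_(x in A) P x = #|[set x in A | P x]|.
Proof.
rewrite cardsE -sum1_card big_mkcondr /=.
by apply: eq_bigr => x _; case: (P x).
Qed.

Lemma is_blockP k n (s : 'S_n) l m :
  reflect (forall i, i < n -> (m <= i < m + k) = (l <= permnat s i < l + k))
          (is_block k s l m).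
Proof.
apply: (iffP eqP) => [e i ni|e].
  have := permnatE s (Ordinal ni) => /= ->.
  have : (s (Ordinal ni) \in [set v : 'I_n | l <= v < l + k])
         = (s (Ordinal ni) \in [set s j | j : 'I_n & m <= j < m + k]) by rewrite e.
  by rewrite mem_imset ?inE //; exact: perm_inj.
apply/setP => v; rewrite -[v](permKV s) mem_imset ?inE ?permKV; last exact: perm_inj.
by rewrite e ?ltn_ord // permnatE permKV.
Qed.

Lemma is_block_with_patternP k n (t : 'S_k) (s : 'S_n) l m : m + k <= n ->
  reflect ((forall i, i < n -> (m <= i < m + k) = (l <= permnat s i < l + k)) /\
           (forall i, i < k -> permnat s (m + i) = l + permnat t i))
          (is_block_with_pattern t s l m).
Proof.
move=> mn; apply: (iffP andP) => [[/is_blockP B /forallP P]|[B P]]; split=> //.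
- move=> i ik; have mi : m + i < n by lia.
  have /forallP/(_ (Ordinal mi)) /= := P (Ordinal ik); rewrite eqxx /= => /eqP.
  have := permnatE s (Ordinal mi) => /= <-; have := permnatE t (Ordinal ik) => /= <-.
  by have := B _ mi; lia.
- exact/is_blockP.
apply/forallP => i; apply/forallP => j; apply/implyP => /eqP e.
by rewrite -!permnatE e P//; apply/eqP; lia.
Qed.

(** Substitutes [t] for the letter at position [m], whose value should be [l];
    later positions and larger values move up by [k - 1]. *)
Definition inflate p k (t : 'S_k) l m (s : 'S_p.+1) : 'S_(p + k) :=
  mkperm (p + k) (fun i =>
    let up v := if v <= l then v else v + k.-1 in
    if m <= i < m + k then l + permnat t (i - m)
    else up (permnat s (if i < m then i else i - k.-1))).

(** Collapses a block at position [m] and value [l]: its first letter represents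
    it, all values of the block become [l], and larger values move down. *)
Definition contract p k l m (s : 'S_(p + k)) : 'S_p.+1 :=
  mkperm p.+1 (fun i =>
    let v := permnat s (if i <= m then i else i + k.-1) in
    if v < l then v else if v < l + k then l else v - k.-1).

Section Block.
Variables (p k l m : nat).
Hypotheses (k0 : 0 < k) (lp : l <= p) (mp : m <= p).

Lemma permnat_inflate (t : 'S_k) (s : 'S_p.+1) : permnat s m = l ->
  forall i, i < p + k -> permnat (inflate t l m s) i =
    let up v := if v <= l then v else v + k.-1 in
    if m <= i < m + k then l + permnat t (i - m)
    else up (permnat s (if i < m then i else i - k.-1)).
Proof.
move=> sml; apply: permnat_mkperm => /= [i ni|i j ni nj].
  have := permnat_lt t (i - m); case: ifP => im; first lia.
  set i' := if i < m then _ else _; have := permnat_lt s i'; rewrite /i'.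
  by do !case: ifP; lia.
have S x : x != m -> permnat s x != l.
  by apply: contra_neq; rewrite -sml => /permnat_inj.
set i' := if i < m then _ else _; set j' := if j < m then _ else _.
case: (boolP (m <= i < m + k)) => im; case: (boolP (m <= j < m + k)) => jm.
- by move=> /addnI/permnat_inj; lia.
- have /S : j' != m by rewrite /j'; case: ifP; lia.
  by have := permnat_lt t (i - m); case: ifP; lia.
- have /S : i' != m by rewrite /i'; case: ifP; lia.
  by have := permnat_lt t (j - m); case: ifP; lia.
- have /S i'l : i' != m by rewrite /i'; case: ifP; lia.
  have /S j'l : j' != m by rewrite /j'; case: ifP; lia.
  move=> e; have /permnat_inj : permnat s i' = permnat s j' by move: e; do !case: ifP; lia.
  by rewrite /i' /j'; do !case: ifP; lia.
Qed.

Lemma inflate_block (t : 'S_k) (s : 'S_p.+1) : permnat s m = l ->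
  is_block_with_pattern t (inflate t l m s) l m.
Proof.
move=> sml; apply/is_block_with_patternP; first lia.
split=> i ni; rewrite permnat_inflate //=; last lia.
  have := permnat_lt t (i - m); case: ifP => im; first lia.
  set i' := if i < m then _ else _.
  have : permnat s i' != l by rewrite -sml (inj_eq (@permnat_inj _ s)) /i'; case: ifP; lia.
  by case: ifP; lia.
by rewrite leq_addr ltn_add2l ni addKn.
Qed.

Lemma inflate_inj (t : 'S_k) (s1 s2 : 'S_p.+1) : permnat s1 m = l -> permnat s2 m = l ->
  inflate t l m s1 = inflate t l m s2 -> s1 = s2.
Proof.
move=> e1 e2 e; apply: permnat_ext => i ni.
case: (ltngtP i m) => im; last by rewrite im e1 e2.
- have := congr1 (fun s => permnat s i) e; rewrite !permnat_inflate //=; try lia.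
  by rewrite im leqNgt im /=; do !case: ifP; lia.
- have := congr1 (fun s => permnat s (i + k.-1)) e; rewrite !permnat_inflate //=; try lia.
  have -> : (m <= i + k.-1 < m + k) = false by lia.
  have -> : (i + k.-1 < m) = false by lia.
  by rewrite addnK; do !case: ifP; lia.
Qed.

Lemma word_inflate (t : 'S_k) (s : 'S_p.+1) : permnat s m = l ->
  word (inflate t l m s) =
    flatten [seq if z == l then map (addn l) (word t) else [:: z] |
      z <- [seq if v <= l then v else v + k.-1 | v <- word s]].
Proof.
move=> sml; rewrite /word /mkseq.
have -> : iota 0 p.+1 = iota 0 m ++ m :: iota m.+1 (p - m).
  by rewrite -[m :: _]/(iota m (p - m).+1) -iotaD; congr iota; lia.
have -> : iota 0 (p + k) = iota 0 m ++ iota m k ++ iota (m + k) (p - m).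
  by rewrite -!iotaD; congr iota; lia.
rewrite !map_cat flatten_cat /= sml leqnn eqxx.
have S x : permnat s x = l -> x = m by rewrite -sml => /permnat_inj.
have F (r : seq nat) : m \notin r -> flatten [seq if z == l then map (addn l) (word t) else [:: z] |
      z <- [seq if v <= l then v else v + k.-1 | v <- map (permnat s) r]] =
  [seq if permnat s i <= l then permnat s i else permnat s i + k.-1 | i <- r].
  elim: r => //= a r IH; rewrite inE negb_or => /andP[am mr]; rewrite IH // ifF //.
  by have := S a; case: ifP; lia.
rewrite !F ?mem_iota; try lia.
congr (_ ++ (_ ++ _)).
- apply/eq_in_map => i; rewrite mem_iota => im; rewrite permnat_inflate //=; last lia.
  have -> : (m <= i < m + k) = false by lia.
  by have -> : i < m by lia.
- rewrite -[in iota m k](addn0 m) iotaDl -!map_comp.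
  apply/eq_in_map => i; rewrite mem_iota => im /=; rewrite permnat_inflate //=; last lia.
  by rewrite addKn ifT //; lia.
- rewrite (_ : m + k = k.-1 + m.+1) ?iotaDl -?map_comp; last lia.
  apply/eq_in_map => i; rewrite mem_iota => im /=; rewrite permnat_inflate //=; last lia.
  have -> : (m <= k.-1 + i < m + k) = false by lia.
  have -> : (k.-1 + i < m) = false by lia.
  by rewrite addKn.
Qed.

Lemma inflate_sep (t : 'S_k) (s : 'S_p.+1) : permnat s m = l ->
  t \in Ssep k -> s \in Ssep p.+1 -> inflate t l m s \in Ssep (p + k).
Proof.
move=> sml /SsepP st /SsepP ss; apply/SsepP; rewrite word_inflate //.
apply: sepseq_inflate.
- by apply: sepseq_map ss => x y _ _; do !case: ifP; lia.
- by apply: sepseq_map st => x y _ _; rewrite ltn_add2l.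
move=> _ _ /mapP[y /mapP[i ik ->] ->] /mapP[v _ ->].
move: ik; rewrite mem_iota /= add0n => ik; have := permnat_lt t i.
by case: ifP; lia.
Qed.

Section Contract.
Variables (s : 'S_(p + k)).
Hypothesis B : forall i, i < p + k -> (m <= i < m + k) = (l <= permnat s i < l + k).

Lemma permnat_contract i : i < p.+1 -> permnat (contract l m s) i =
    let v := permnat s (if i <= m then i else i + k.-1) in
    if v < l then v else if v < l + k then l else v - k.-1.
Proof.
move: i; apply: permnat_mkperm => /= [i ni|i j ni nj].
  set i' := if i <= m then _ else _; have i'n : i' < p + k by rewrite /i'; case: ifP; lia.
  by have := permnat_lt s i'; do !case: ifP; lia.
set i' := if i <= m then _ else _; set j' := if j <= m then _ else _.
have i'n : i' < p + k by rewrite /i'; case: ifP; lia.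
have j'n : j' < p + k by rewrite /j'; case: ifP; lia.
have := B i'n; have := B j'n; have := @permnat_inj _ s i' j'.
by rewrite /i' /j'; do !case: ifP; lia.
Qed.

Lemma contract_point : permnat (contract l m s) m = l.
Proof.
rewrite permnat_contract //= leqnn; have := @B m.
by do !case: ifP; lia.
Qed.

(** The contraction is order isomorphic to the subword of [s] that keeps a single
    letter of the block. *)
Lemma contract_sep : s \in Ssep (p + k) -> contract l m s \in Ssep p.+1.
Proof.
move=> /SsepP ss; apply/SsepP.
have -> : word (contract l m s) =
  [seq if v < l then v else if v < l + k then l else v - k.-1 |
    v <- [seq permnat s i | i <- iota 0 m.+1 ++ iota (m + k) (p - m)]].
  rewrite /word /mkseq; have -> : iota 0 p.+1 = iota 0 m.+1 ++ iota m.+1 (p - m).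
    by rewrite -iotaD; congr iota; lia.
  rewrite !map_cat; congr (_ ++ _).
    rewrite -map_comp; apply/eq_in_map => i; rewrite mem_iota => im /=.
    rewrite permnat_contract /=; last lia.
    by have -> : i <= m by lia.
  rewrite -map_comp (_ : m + k = k.-1 + m.+1) ?iotaDl -?map_comp; last lia.
  apply/eq_in_map => i; rewrite mem_iota => im /=.
  rewrite permnat_contract /=; last lia.
  have -> : (i <= m) = false by lia.
  by rewrite (addnC i).
apply: sepseq_map; last apply: sepseq_subseq ss _ _.
- move=> _ _ /mapP[i + ->] /mapP[j + ->]; rewrite !mem_cat !mem_iota => im jm.
  have ni : i < p + k by lia. have nj : j < p + k by lia.
  case: (eqVneq i j) => [->|ij]; first by rewrite !ltnn.
  by have := B ni; have := B nj; have := @permnat_inj _ s i j; do !case: ifP; lia.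
- apply: map_subseq.
  have -> : iota 0 (p + k) = iota 0 m.+1 ++ iota m.+1 k.-1 ++ iota (m + k) (p - m).
    rewrite (_ : m + k = m.+1 + k.-1) -?iotaD; last lia.
    by congr iota; lia.
  by apply: cat_subseq => //; apply: suffix_subseq.
- by rewrite size_map size_cat size_iota.
Qed.

Lemma pattern_sep : s \in Ssep (p + k) ->
  exists2 t : 'S_k, t \in Ssep k & forall i, i < k -> permnat s (m + i) = l + permnat t i.
Proof.
move=> /SsepP ss.
have pt i : i < k -> permnat (mkperm k (fun i => permnat s (m + i) - l)) i = permnat s (m + i) - l.
  move: i; apply: permnat_mkperm => [i ik|i j ik jk].
    by have := @B (m + i); lia.
  by have := @B (m + i); have := @B (m + j); have := @permnat_inj _ s (m + i) (m + j); lia.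
exists (mkperm k (fun i => permnat s (m + i) - l)) => [|i ik]; last first.
  by rewrite pt //; have := @B (m + i); lia.
apply/SsepP.
have -> : word (mkperm k (fun i => permnat s (m + i) - l)) =
   [seq v - l | v <- [seq permnat s i | i <- iota m k]].
  rewrite /word /mkseq -[m in RHS]addn0 iotaDl -!map_comp.
  by apply/eq_in_map => i; rewrite mem_iota => ik /=; rewrite pt.
apply: sepseq_map; last apply: sepseq_subseq ss _ _.
- move=> _ _ /mapP[i + ->] /mapP[j + ->]; rewrite !mem_iota => im jm.
  by have := @B i; have := @B j; lia.
- apply: map_subseq.
  have -> : iota 0 (p + k) = iota 0 m ++ iota m k ++ iota (m + k) (p - m).
    by rewrite -!iotaD; congr iota; lia.
  apply: subseq_trans (suffix_subseq _ _).
  exact: prefix_subseq.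
- by rewrite size_map size_iota.
Qed.

End Contract.

Lemma contract_inj (t : 'S_k) (s1 s2 : 'S_(p + k)) :
  is_block_with_pattern t s1 l m -> is_block_with_pattern t s2 l m ->
  contract l m s1 = contract l m s2 -> s1 = s2.
Proof.
have mpk : m + k <= p + k by lia.
move=> /(is_block_with_patternP _ _ _ mpk)[B1 P1] /(is_block_with_patternP _ _ _ mpk)[B2 P2] e.
apply: permnat_ext => i ni; case: (boolP (m <= i < m + k)) => im.
  by rewrite (_ : i = m + (i - m)) ?P1 ?P2; lia.
pose j := if i < m then i else i - k.-1.
have := congr1 (fun s => permnat s j) e; rewrite !permnat_contract //=;
  try by rewrite /j; case: ifP; lia.
have -> : (if j <= m then j else j + k.-1) = i by rewrite /j; do !case: ifP; lia.
by have := B1 _ ni; have := B2 _ ni; do !case: ifP; lia.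
Qed.

(** Both directions are injections between the two sets: a permutation with a
    block at a known place is determined by its contraction and the pattern. *)
Lemma card_block_pattern (t : 'S_k) : t \in Ssep k ->
  #|[set s in Ssep (p + k) | is_block_with_pattern t s l m]| =
  #|[set s in Ssep p.+1 | permnat s m == l]|.
Proof.
move=> st; have mpk : m + k <= p + k by lia.
apply/eqP; rewrite eqn_leq; apply/andP; split.
  rewrite -(@card_in_imset _ _ (@contract p k l m)); last first.
    by move=> s1 s2 /[!inE] /andP[_ b1] /andP[_ b2]; apply: contract_inj b1 b2.
  apply/subset_leq_card/fintype.subsetP => _ /imsetP[s /[1!inE] /andP[ss b] ->].
  have [B _] := elimT (is_block_with_patternP _ _ _ mpk) b.
  by rewrite inE contract_sep //= contract_point.
rewrite -(@card_in_imset _ _ (inflate t l m)); last first.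
  by move=> s1 s2 /[!inE] /andP[_ /eqP b1] /andP[_ /eqP b2]; apply: inflate_inj.
apply/subset_leq_card/fintype.subsetP => _ /imsetP[s /[1!inE] /andP[ss /eqP b] ->].
by rewrite inE inflate_sep //= inflate_block.
Qed.

End Block.

Lemma NblockE k n (s : 'S_n) : Nblock k s =
  \sum_(lm : 'I_(n - k).+1 * 'I_(n - k).+1) is_block k s lm.1 lm.2.
Proof.
rewrite /Nblock -sum1_card big_mkcond; apply: eq_bigr => lm _.
by rewrite inE; case: is_block.
Qed.

Lemma Nblock_patternE k n (t : 'S_k) (s : 'S_n) : Nblock_pattern t s =
  \sum_(lm : 'I_(n - k).+1 * 'I_(n - k).+1) is_block_with_pattern t s lm.1 lm.2.
Proof.
rewrite /Nblock_pattern -sum1_card big_mkcond; apply: eq_bigr => lm _.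
by rewrite inE; case: is_block_with_pattern.
Qed.

(** Every marked letter of a permutation of size [p + 1] has exactly one position
    and one value, so summing [card_block_pattern] over all places counts the
    letters of the separable permutations of size [p + 1]. *)
Lemma sum_Nblock_pattern p k (t : 'S_k) : 0 < k -> t \in Ssep k ->
  \sum_(s in Ssep (p + k)) Nblock_pattern t s = p.+1 * #|Ssep p.+1|.
Proof.
move=> k0 st; under eq_bigr do rewrite Nblock_patternE addnK.
rewrite exchange_big /=.
have L (lm : 'I_p.+1 * 'I_p.+1) : \sum_(s in Ssep (p + k))
   is_block_with_pattern t s lm.1 lm.2 = \sum_(s in Ssep p.+1) (s lm.2 == lm.1).
  have [lp mp] : lm.1 <= p /\ lm.2 <= p by rewrite -!(ltnS _ p) !ltn_ord.
  rewrite !sum_bool_card (card_block_pattern k0 lp mp st).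
  by apply: eq_card => s; rewrite !inE permnatE.
rewrite (eq_bigr _ (fun lm _ => L lm)) exchange_big /=.
rewrite (eq_bigr (fun=> p.+1)) ?sum_nat_const 1?mulnC // => s _.
rewrite -(pair_bigA _ (fun l m => nat_of_bool (s m == l))) /= exchange_big /=.
rewrite (eq_bigr (fun=> 1)) ?sum_nat_const ?card_ord ?muln1 // => m _.
by rewrite (bigD1 (s m)) //= eqxx big1 // => l; rewrite eq_sym => /negbTE ->.
Qed.

(** Each block has exactly one pattern, and this pattern is separable because it
    is a pattern of [s]. *)
Lemma Nblock_sum p k (s : 'S_(p + k)) : 0 < k -> s \in Ssep (p + k) ->
  Nblock k s = \sum_(t in Ssep k) Nblock_pattern t s.
Proof.
move=> k0 ss; rewrite NblockE; under [RHS]eq_bigr do rewrite Nblock_patternE.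
rewrite exchange_big /=; apply: eq_bigr => -[[l lp] [m mp]] _ /=.
rewrite !addnK !ltnS in lp mp; have mpk : m + k <= p + k by lia.
case: (boolP (is_block k s l m)) => [/is_blockP B|/negbTE nB]; last first.
  by rewrite big1 // => t _; rewrite /is_block_with_pattern nB.
have [t st P] := pattern_sep k0 lp mp B ss.
rewrite (bigD1 t) //= big1 ?addn0 => [|t' /andP[_ t't]].
  suff -> : is_block_with_pattern t s l m by [].
  by apply/is_block_with_patternP.
apply/eqP; rewrite eqb0; apply/negP => /(is_block_with_patternP _ _ _ mpk) [_ P'].
case/eqP: t't; apply: permnat_ext => i ik; apply: (@addnI l).
by rewrite -P // -P'.
Qed.

Lemma sum_Nblock p k : 0 < k ->
  \sum_(s in Ssep (p + k)) Nblock k s = p.+1 * #|Ssep p.+1| * #|Ssep k|.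
Proof.
move=> k0; rewrite (eq_bigr _ (fun s ss => Nblock_sum k0 ss)) exchange_big /=.
rewrite (eq_bigr _ (fun t st => sum_Nblock_pattern p k0 st)).
by rewrite sum_nat_const mulnC.
Qed.

(** * Counting separable permutations by their first direct summand *)

Definition splits (b : bool) (w : seq nat) (h : nat) : bool :=
  allrel (ltn_dir b) (take h w) (drop h w).

Definition decomposable b w := has (splits b w) (iota 1 (size w).-1).

Lemma decomposableP b w :
  reflect (exists2 h, 0 < h < size w & splits b w h) (decomposable b w).
Proof.
apply: (iffP hasP) => -[h]; rewrite ?mem_iota => hw sh; exists h => //.
  by lia.
by rewrite mem_iota; lia.
Qed.

Lemma sepseq_decomposable w : sepseq w -> 1 < size w ->
  decomposable true w || decomposable false w.
Proof.
case=> // b u v su sv uv _.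
have D : decomposable b (u ++ v).
  apply/decomposableP; exists (size u); last by rewrite /splits take_size_cat ?drop_size_cat.
  by rewrite size_cat; have := sepseq_size su; have := sepseq_size sv; lia.
by case: b uv D => _ ->; rewrite ?orbT.
Qed.

(** Any cut leaves the first letter on one side and the last letter on the other,
    so the order of these two letters tells direct from skew decompositions. *)
Lemma decomposable_ends b w : decomposable b w -> ltn_dir b (head 0 w) (last 0 w).
Proof.
move=> /decomposableP[h hw /allrelP]; apply.
  have st : size (take h w) = h by rewrite size_takel //; lia.
  by rewrite -nth0 -(@nth_take h) ?mem_nth ?st //; lia.
rewrite -nth_last (_ : (size w).-1 = h + ((size w).-1 - h)); last first.
  by lia.
rewrite -nth_drop mem_nth // size_drop. case/andP: hw => _ hw.
by rewrite ltn_sub2r // prednK // (leq_ltn_trans _ hw).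
Qed.

Lemma decomposable_excl w : decomposable true w -> decomposable false w -> False.
Proof. by move=> /decomposable_ends /= + /decomposable_ends /=; lia. Qed.

Lemma splits_rev b w h : h <= size w -> splits b (rev w) h = splits (~~ b) w (size w - h).
Proof.
move=> hw; rewrite /splits take_rev drop_rev.
apply/allrelP/allrelP => H x y; have := H y x; rewrite ?mem_rev => + xw yw;
  by rewrite xw yw /ltn_dir; case: (b); apply.
Qed.

Lemma decomposable_rev b w : decomposable b (rev w) = decomposable (~~ b) w.
Proof.
apply/decomposableP/decomposableP => -[h]; rewrite size_rev => hw sh.
  by exists (size w - h); [lia | rewrite -splits_rev //; lia].
exists (size w - h); first lia.
by rewrite splits_rev ?subKn //; lia.
Qed.

Lemma size_word n (s : 'S_n) : size (word s) = n.
Proof. exact: size_mkseq. Qed.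

Lemma word_uniq n (s : 'S_n) : uniq (word s).
Proof. by rewrite mkseq_uniq //; exact: permnat_inj. Qed.

Lemma word_inj n : injective (@word n).
Proof.
move=> s t e; apply: permnat_ext => i ni.
by rewrite -(nth_mkseq 0 (permnat s) ni) -[mkseq _ _]/(word s) e nth_mkseq.
Qed.

Lemma mem_word n (s : 'S_n) x : (x \in word s) = (x < n).
Proof.
apply/mapP/idP => [[i]|xn]; first by rewrite mem_iota => ni ->; rewrite permnat_lt.
by have [i ni <-] := permnat_surj s xn; exists i; rewrite ?mem_iota.
Qed.

Definition reversal n (s : 'S_n) : 'S_n := mkperm n (fun i => permnat s (n.-1 - i)).

Lemma word_reversal n (s : 'S_n) : word (reversal s) = rev (word s).
Proof.
apply: (@eq_from_nth _ 0); rewrite ?size_rev !size_word // => i ni.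
rewrite nth_rev ?size_word // !nth_mkseq ?permnat_mkperm //; try lia.
- by congr permnat; lia.
- by move=> j nj; rewrite permnat_lt; lia.
- by move=> j h nj nh /permnat_inj; lia.
Qed.

(** Reversal is injective and turns direct sums into skew sums. *)
Lemma card_decomposable_sym n b :
  #|[set s in Ssep n | decomposable b (word s)]|
  <= #|[set s in Ssep n | decomposable (~~ b) (word s)]|.
Proof.
have inj : injective (@reversal n).
  move=> s t /(congr1 (@word n)); rewrite !word_reversal => /(congr1 rev).
  by rewrite !revK => /word_inj.
rewrite -(card_imset _ inj); apply/subset_leq_card/fintype.subsetP => _ /imsetP[s + ->].
rewrite [in X in X -> _]finset.in_set => /andP[/SsepP ss ds].
rewrite finset.in_set word_reversal decomposable_rev negbK ds andbT.
by apply/SsepP; rewrite word_reversal; apply: sepseq_rev.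
Qed.

Lemma card_split (T : finType) (A : {set T}) (P : pred T) :
  #|A| = #|[set x in A | P x]| + #|[set x in A | ~~ P x]|.
Proof.
rewrite -[LHS](cardsID [set x | P x]).
by congr (_ + _); apply: eq_card => x; rewrite !inE // andbC.
Qed.

(** Exactly one of the two kinds of decomposition exists, and by reversal both
    kinds are equally frequent. *)
Lemma card_Ssep_decomposable n : 1 < n ->
  #|Ssep n| = #|[set s in Ssep n | decomposable true (word s)]|.*2.
Proof.
move=> n1; rewrite -addnn.
have -> : #|Ssep n| = #|[set s in Ssep n | decomposable true (word s)]| +
   #|[set s in Ssep n | decomposable false (word s)]|.
  rewrite [LHS](card_split _ (fun s => decomposable true (word s))); congr (_ + _).
  apply: eq_card => s; rewrite [LHS]finset.in_set [RHS]finset.in_set.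
  apply: andb_id2l => /SsepP ss.
  have := sepseq_decomposable ss; rewrite size_word => /(_ n1).
  have := @decomposable_excl (word s).
  by do 2 case: decomposable => //; move=> /(_ isT isT).
congr (_ + _); apply/eqP; rewrite eqn_leq.
by rewrite (card_decomposable_sym n false) (card_decomposable_sym n true).
Qed.

Definition perm_dsum i j (st : 'S_i * 'S_j) : 'S_(i + j) :=
  mkperm (i + j) (fun x => if x < i then permnat st.1 x else i + permnat st.2 (x - i)).

Lemma word_perm_dsum i j (s : 'S_i) (t : 'S_j) :
  word (perm_dsum (s, t)) = word s ++ map (addn i) (word t).
Proof.
have E : forall x, x < i + j -> permnat (perm_dsum (s, t)) x =
    if x < i then permnat s x else i + permnat t (x - i).
  apply: permnat_mkperm => /= [x xn|x y xn yn].
    by have := permnat_lt s x; have := permnat_lt t (x - i); case: ifP; lia.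
  have := permnat_lt s x; have := permnat_lt s y.
  have := @permnat_inj _ s x y; have := @permnat_inj _ t (x - i) (y - i).
  by do !case: ifP; lia.
rewrite /word /mkseq iotaD map_cat; congr (_ ++ _).
  by apply/eq_in_map => x; rewrite mem_iota => xi; rewrite E ?ifT //; lia.
rewrite add0n -[i in iota i j]addn0 iotaDl -!map_comp.
apply/eq_in_map => x; rewrite mem_iota => xi /=; rewrite E; last lia.
by rewrite ltnNge leq_addr addKn.
Qed.

Lemma perm_dsum_inj i j : injective (@perm_dsum i j).
Proof.
move=> [s t] [s' t'] /(congr1 (@word _)) /eqP; rewrite !word_perm_dsum.
rewrite eqseq_cat ?size_word // => /andP[/eqP/word_inj -> /eqP e].
by congr (_, _); apply: word_inj; apply: inj_map e; exact: addnI.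
Qed.

Lemma allrel_perm_dsum i j (s : 'S_i) (t : 'S_j) :
  allrel (ltn_dir true) (word s) (map (addn i) (word t)).
Proof.
by apply/allrelP => x y; rewrite mem_word => xi /mapP[z _ ->] /=; lia.
Qed.

Lemma perm_dsum_Ssep i j (s : 'S_i) (t : 'S_j) : 0 < i -> 0 < j ->
  (perm_dsum (s, t) \in Ssep (i + j)) = (s \in Ssep i) && (t \in Ssep j).
Proof.
move=> i0 j0; apply/SsepP/andP; rewrite word_perm_dsum; last move=> [/SsepP ss /SsepP st].
  move=> sw; split; apply/SsepP.
    by apply: sepseq_subseq sw (prefix_subseq _ _) _; rewrite size_word.
  have {}sw : sepseq (map (addn i) (word t)).
    by apply: sepseq_subseq sw (suffix_subseq _ _) _; rewrite size_map size_word.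
  rewrite -[word t]map_id (_ : map id _ = map (subn^~ i) (map (addn i) (word t))).
    by apply: sepseq_map sw => _ _ /mapP[x _ ->] /mapP[y _ ->]; lia.
  by rewrite -map_comp; apply: eq_map => x /=; rewrite addKn.
apply: (@sepseq_cat true) => //; last exact: allrel_perm_dsum.
by apply: sepseq_map st => x y _ _; rewrite ltn_add2l.
Qed.

Lemma splits_perm_dsum i j (s : 'S_i) (t : 'S_j) h : h <= i ->
  splits true (word (perm_dsum (s, t))) h = splits true (word s) h.
Proof.
move=> hi; rewrite word_perm_dsum /splits takel_cat ?size_word // drop_cat size_word.
have R h' : allrel (ltn_dir true) (take h' (word s)) (map (addn i) (word t)).
  by apply/allrelP => x y /mem_take xs; apply: (allrelP (allrel_perm_dsum s t)).
case: ltnP => hi'; first by rewrite allrel_catr R andbT.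
by rewrite (_ : h = i) ?subnn ?drop0; [rewrite R drop_oversize ?size_word ?allrel0r | lia].
Qed.

(** If every letter before [i] is smaller than every letter from [i] on, then by
    counting the former are the values below [i]. *)
Lemma splits_ex_perm_dsum i j (s : 'S_(i + j)) : splits true (word s) i ->
  exists st, s = perm_dsum st.
Proof.
move=> /allrelP H.
have memt x : x < i -> permnat s x \in take i (word s).
  move=> xi; rewrite -(nth_mkseq 0 (permnat s) (_ : x < i + j)); last lia.
  rewrite -(nth_take _ xi) mem_nth // size_takel ?size_word //; lia.
have memd x : i <= x < i + j -> permnat s x \in drop i (word s).
  move=> xi; rewrite -(nth_mkseq 0 (permnat s) (_ : x < i + j)); last lia.
  rewrite (_ : x = i + (x - i)) -?nth_drop ?mem_nth ?size_drop ?size_mkseq; lia.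
have lo x : x < i -> permnat s x < i.
  move=> xi; have : size (drop i (word s)) <=
      size (iota (permnat s x).+1 (i + j - (permnat s x).+1)).
    (* the letters from i on are j distinct values above permnat s x *)
    apply: uniq_leq_size; first exact: drop_uniq (word_uniq s).
    move=> y yd; have := H _ _ (memt _ xi) yd; have := mem_drop yd.
    by rewrite mem_word mem_iota /=; lia.
  by have := permnat_lt s x; rewrite size_drop size_word size_iota; lia.
have hi x : i <= x < i + j -> i <= permnat s x < i + j.
  move=> xi; have : size (take i (word s)) <= size (iota 0 (permnat s x)).
    apply: uniq_leq_size; first exact: take_uniq (word_uniq s).
    by move=> y yd; have := H _ _ yd (memd _ xi); rewrite mem_iota.
  have := permnat_lt s x; rewrite size_take size_word size_iota.
  by case: ifP; lia.
exists (mkperm i (permnat s), mkperm j (fun x => permnat s (i + x) - i)).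
apply: word_inj; rewrite word_perm_dsum /word /mkseq iotaD map_cat; congr (_ ++ _).
  apply/eq_in_map => x; rewrite mem_iota => xi; rewrite permnat_mkperm //.
  by move=> y z _ _ /permnat_inj.
rewrite add0n -[i in iota i j]addn0 iotaDl -!map_comp.
apply/eq_in_map => x; rewrite mem_iota => xi /=; rewrite permnat_mkperm //.
- by have := hi (i + x); lia.
- by move=> y yj; have := hi (i + y); lia.
- move=> y z yj zj; have := hi (i + y); have := hi (i + z).
  by have := @permnat_inj _ s (i + y) (i + z); lia.
Qed.

Definition first_split w i :=
  [&& 0 < i, splits true w i & all (fun h => ~~ splits true w h) (iota 1 i.-1)].

(** A decomposable word has exactly one first split, any other word none. *)
Lemma sum_first_split w : \sum_(i < size w) first_split w i = decomposable true w.
Proof.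
case: (boolP (decomposable true w)) => [/decomposableP exh|]; last first.
  move=> nd; rewrite big1 // => i _; apply/eqP; rewrite eqb0; apply: contra nd.
  by move=> /and3P[i0 si _]; apply/decomposableP; exists i; rewrite ?i0 ?ltn_ord.
have {exh} exh : exists h, (0 < h < size w) && splits true w h.
  by case: exh => h h1 h2; exists h; rewrite h1.
case: (ex_minnP exh) => h /andP[hw sh] hmin.
have hn : h < size w by lia.
rewrite (bigD1 (Ordinal hn)) //= big1 ?addn0.
  rewrite /first_split sh (_ : 0 < h) /=; last lia.
  suff -> : all (fun h => ~~ splits true w h) (iota 1 h.-1) by [].
  apply/allP => g; rewrite mem_iota => gh; apply/negP => sg.
  by have := hmin g; rewrite sg; lia.
move=> g gh; apply/eqP; rewrite eqb0; apply/negP => /and3P[g0 sg /allP al].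
have hg : h <= g by apply: hmin; rewrite sg g0 ltn_ord.
have : h \in iota 1 g.-1.
  rewrite mem_iota; have : h != g by apply: contra gh => /eqP e; apply/eqP/val_inj.
  by lia.
by move=> /al; rewrite sh.
Qed.

Definition num_indec i := #|[set s in Ssep i | ~~ decomposable true (word s)]|.

(** No split before [i] means that the summand on the first [i] positions is
    indecomposable; the second summand is arbitrary. *)
Lemma card_first_split i j : 0 < i -> 0 < j ->
  #|[set s in Ssep (i + j) | first_split (word s) i]| = num_indec i * #|Ssep j|.
Proof.
move=> i0 j0; rewrite -cardsX -(card_imset _ (@perm_dsum_inj i j)).
have F (s : 'S_i) (t : 'S_j) :
    first_split (word (perm_dsum (s, t))) i = ~~ decomposable true (word s).
  rewrite /first_split i0 splits_perm_dsum // {1}/splits drop_oversize ?size_word // allrel0r /=.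
  rewrite /decomposable size_word -all_predC; apply: eq_in_all => h.
  by rewrite mem_iota => hi /=; rewrite splits_perm_dsum //; lia.
apply: eq_card => s; rewrite finset.in_set; apply/andP/imsetP => [[ss fs]|].
  have [[s1 s2] e] := splits_ex_perm_dsum (proj1 (andP (proj2 (andP fs)))); subst s.
  move: ss fs; rewrite F perm_dsum_Ssep // => /andP[s1s s2s] d.
  by exists (s1, s2) => //; rewrite finset.in_setX finset.in_set /= s1s d.
move=> [[s1 s2] + ->]; rewrite finset.in_setX finset.in_set F perm_dsum_Ssep //=.
by move=> /andP[/andP[-> ->] ->].
Qed.

Lemma card_decomposable n : #|[set s in Ssep n | decomposable true (word s)]| =
  \sum_(i < n | 0 < i) num_indec i * #|Ssep (n - i)|.
Proof.
rewrite -sum_bool_card.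
under eq_bigr => s _ do rewrite -sum_first_split size_word.
rewrite exchange_big [RHS]big_mkcond /=; apply: eq_bigr => -[i ni] _ /=.
rewrite sum_bool_card; case: (posnP i) => [->|i0] /=.
  by apply/eqP; rewrite cards_eq0; apply/eqP/setP => s; rewrite finset.in_set finset.in_set0 andbF.
rewrite -card_first_split //; last lia.
by rewrite subnKC // ltnW.
Qed.

Lemma card_Ssep0 : #|Ssep 0| = 0.
Proof.
apply/eqP; rewrite cards_eq0; apply/eqP/setP => s; rewrite [RHS]finset.in_set0.
by apply/negP => /SsepP/sepseq_size.
Qed.

Lemma card_Ssep1 : #|Ssep 1| = 1.
Proof.
rewrite (_ : Ssep 1 = [set: 'S_1]%SET) ?cardsT ?card_Sn //.
apply/setP => s; rewrite [RHS]finset.in_setT; apply/SsepP; exact: sepseq1.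
Qed.

(** From size 2 on, half of the separable permutations are indecomposable by
    [card_Ssep_decomposable]; the unique one of size 1 is the exception. *)
Lemma num_indec_double i : 0 < i -> (num_indec i).*2 = #|Ssep i| + (i == 1).
Proof.
move=> i0; have := card_split (Ssep i) (fun s => decomposable true (word s)).
rewrite -/(num_indec i); case: (ltngtP i 1) => [|i1|->]; first lia.
  by rewrite (card_Ssep_decomposable i1); lia.
rewrite card_decomposable big1 ?card_Ssep1 => [|j]; last by case: j => -[].
by lia.
Qed.

(** Double [card_decomposable]: the terms i < n give the convolution, and the
    correction at i = 1 in [num_indec_double] gives the term of size n - 1.  The
    summands i = 0 and i = n vanish. *)
Lemma card_Ssep_rec n : 1 < n ->
  #|Ssep n| = #|Ssep n.-1| + \sum_(i < n.+1) #|Ssep i| * #|Ssep (n - i)|.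
Proof.
move=> n1; rewrite big_ord_recr /= subnn card_Ssep0 muln0 addn0.
rewrite (card_Ssep_decomposable n1) card_decomposable -mul2n big_distrr /=.
rewrite (eq_bigr (fun i : 'I_n =>
  #|Ssep i| * #|Ssep (n - i)| + (val i == 1) * #|Ssep (n - i)|)); last first.
  by move=> i i0; rewrite mulnA mul2n num_indec_double // mulnDl.
rewrite big_split /= addnC; congr (_ + _).
  rewrite (bigD1 (Ordinal n1)) //= big1 ?addn0 ?mul1n ?subn1 // => i /andP[_ i1].
  by rewrite (_ : val i == 1 = false) //; apply: contraNF i1 => /eqP e; apply/eqP/val_inj.
rewrite big_mkcond /=; apply: eq_bigr => i _; case: (posnP i) => //= ->.
by rewrite card_Ssep0.
Qed.

(** * Asymptotics of sequences satisfying the recurrence *)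

Import Order.TTheory GRing.Theory Num.Theory.
Import numFieldNormedType.Exports.

Local Open Scope classical_set_scope.
Local Open Scope ring_scope.

(** The differential equation of the generating function, carried out with a
    truncation of it: the quadratic equation holds up to a polynomial [F] that
    vanishes to high order and does not reach the coefficient of ['X^n]. *)
Lemma schroeder_three_term (R : numDomainType) (s : nat -> R) : s 0%N = 0 -> s 1%N = 1 ->
  (forall n, (2 <= n)%N -> s n = s n.-1 + \sum_(i < n.+1) s i * s (n - i)%N) ->
  forall n, (2 <= n)%N -> n.+1%:R * s n.+1 = (6 * n%:R - 3) * s n - (n%:R - 2) * s n.-1.
Proof.
move=> s0 s1 sr n n2.
pose N := n.+2; pose S : {poly R} := \poly_(i < N) s i.
pose F := S ^+ 2 + ('X - 1) * S + 'X.
have F0 i : (i < N)%N -> F`_i = 0.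
  move=> iN; rewrite /F !coefD expr2 coefM mulrBl mul1r coefB coefXM !coefX.
  have -> : \sum_(j < i.+1) S`_j * S`_(i - j) = \sum_(j < i.+1) s j * s (i - j)%N.
    by apply: eq_bigr => -[j /= ji] _; rewrite !coef_poly ?ifT //; lia.
  rewrite !coef_poly iN; case: i iN => [|[|i]] iN /=.
  - by rewrite big_ord1 s0; ring.
  - by rewrite !big_ord_recr big_ord0 /= s0 s1; ring.
  - by rewrite ifT ?(sr i.+2) //=; [ring|lia].
pose W := 1 - 'X - 2 *: S.
pose D : {poly R} := 1 - 6 *: 'X + 'X ^+ 2.
have WD : W ^+ 2 = D + 4 *: F by rewrite /W /D /F -!mul_polyC; ring.
(* differentiate W^2, then multiply by W to replace W^2 once more *)
have dW : 2 *: (D * W^`()) = D^`() * W + 4 *: (F^`() * W) - 8 *: (F * W^`()).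
  have : (W ^+ 2)^`() = (D + 4 *: F)^`() by rewrite WD.
  rewrite expr2 derivM derivD derivZ => e.
  have : W * (W * W^`() *+ 2) = W * (D^`() + 4 *: F^`()).
    by rewrite -e; ring.
  have -> : W * (W * W^`() *+ 2) = 2 *: (W ^+ 2 * W^`()) by rewrite -mul_polyC; ring.
  rewrite WD -!mul_polyC => /eqP; rewrite -subr_eq0 => /eqP h.
  by apply/eqP; rewrite -subr_eq0 -h; apply/eqP; ring.
have low (P Q : {poly R}) M : (forall i, (i < M)%N -> P`_i = 0) ->
    forall i, (i < M)%N -> (P * Q)`_i = 0.
  by move=> P0 i iM; rewrite coefM big1 // => -[j /= ji] _; rewrite P0 ?mul0r //; lia.
have F'0 i : (i < n.+1)%N -> F^`()`_i = 0 by move=> iN; rewrite coef_deriv F0 ?mul0rn.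
have := congr1 (fun P : {poly R} => P`_n) dW.
rewrite coefB coefD !coefZ (low F^`() W n.+1 F'0 n (ltnSn n)).
rewrite (low F W^`() N F0 n (ltnW (ltnSn n.+1))).
have -> : D^`() = 2 *: 'X - 6%:P.
  by rewrite /D derivD derivB derivZ derivXn derivX poly.derivE -!mul_polyC; ring.
have -> : D * W^`() = W^`() - 6 *: ('X * W^`()) + 'X * ('X * W^`()).
  by rewrite /D -!mul_polyC; ring.
have -> : (2 *: 'X - 6%:P) * W = 2 *: ('X * W) - 6 *: W by rewrite -!mul_polyC; ring.
have cW i : (1 < i < N)%N -> W`_i = - 2 * s i.
  move=> /andP[i1 iN]; rewrite /W !coefB coefZ coefX coef1 coef_poly iN.
  by case: i i1 {iN} => [|[|i]] //= _; ring.
clearbody W D; rewrite !(coefB, coefD, coefZ, coefXM, coef_deriv) {dW WD}.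
have {cW} cW := cW : forall i, (1 < i < n.+2)%N -> _.
clear N S F F0 F'0 sr low.
(* W has coefficients -2 s_i, so equating coefficients gives the claim times -4 *)
have alg (a b c d : R) : - 4 * (a - b) = c - d -> c = d -> a = b.
  by move=> h /eqP; rewrite -subr_eq0 -h mulf_eq0 oppr_eq0 pnatr_eq0 /= subr_eq0 => /eqP.
(* for n = 2 the coefficient of 'X, which is not of the form -2 s_i, cancels *)
case: n n2 cW => [|[|[|n]]] // _ cW /=; last first.
  rewrite (cW n.+2) ?(cW n.+3) ?(cW n.+4) ?ltnS ?leqnn ?leqnSn ?leqW //.
  by move=> e; apply: (alg _ _ _ _ _ e); ring.
by rewrite (cW 3%N) ?(cW 2%N) //; move=> e; apply: (alg _ _ _ _ _ e); ring.
Qed.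

Section Ratio.
Variables (R : realType) (s : nat -> R).
Hypothesis s_gt0 : forall n, (0 < n)%N -> 0 < s n.
Hypothesis s_le : forall n, (0 < n)%N -> s n <= s n.+1.
Hypothesis s12 : s 2%N = 2 * s 1%N.
Hypothesis s_rec : forall n, (2 <= n)%N ->
  n.+1%:R * s n.+1 = (6 * n%:R - 3) * s n - (n%:R - 2) * s n.-1.

Local Notation rho := (3 + 2 * Num.sqrt 2 : R).

(** The last equation says that [rho] is fixed by r |-> 6 - 1 / r. *)
Lemma rho_bounds : [/\ 5 <= rho, rho <= 6 & rho * (6 - rho) = 1].
Proof.
have h : Num.sqrt 2 ^+ 2 = 2 :> R by rewrite sqr_sqrtr.
have h1 : 1 <= Num.sqrt 2 :> R by rewrite -[leLHS]sqrtr1 ler_wsqrtr // ler1n.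
split; [by lra| by nra |].
have -> : rho * (6 - rho) = 9 - 4 * Num.sqrt 2 ^+ 2 by ring.
by rewrite h; ring.
Qed.

(** With u = 1 / r_(n-1) and v = 1 / rho, the recurrence reads
    r_n - rho = v - u + (3 u - 9) / (n + 1), where v - u = u v (r_(n-1) - rho)
    and u v <= 1/5.  Since 1/5 * 48 / n is at most 3/10 * 48 / (n + 1) and the
    last term is at most 9 / (n + 1) in absolute value, the constant 48
    reproduces itself. *)
Lemma ratio_dist_le n : (0 < n)%N -> `|s n.+1 / s n - rho| <= 48 / n.+1%:R.
Proof.
have [r5 r6 rr] := rho_bounds.
elim: n => // -[|n] IH _.
  by rewrite s12 mulfK ?gt_eqF ?s_gt0 // ler_norml; apply/andP; split; lra.
have {IH} := IH isT.
have := @s_rec n.+2 isT; rewrite /= -[n.+3%:R]natr1.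
have a0 := @s_gt0 n.+1 isT; have b0 := @s_gt0 n.+2 isT.
have := @s_le n.+1 isT; move: a0 b0.
have : 2 <= n.+2%:R :> R by rewrite ler_nat.
move: (s n.+1) (s n.+2) (s n.+3) (n.+2%:R : R) => a b c M M2 a0 b0 ab rec.
rewrite !ler_norml; have [v hv] : exists v, v = 6 - rho by exists (6 - rho).
rewrite -hv in rr.
have v0 : 0 < v by nra.
have v5 : v <= 1 / 5 by nra.
set r := b / a; pose u := a / b.
have ru : r * u = 1 by rewrite /r /u; field; rewrite !gt_eqF.
have u0 : 0 < u by rewrite divr_gt0.
have u1 : u <= 1 by rewrite ler_pdivrMr ?mul1r.
have -> : c / b - rho = v - u + (3 * u - 9) / (M + 1).
  have -> : c = ((6 * M - 3) * b - (M - 2) * a) / (M + 1).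
    by rewrite -rec mulrC mulKf // gt_eqF //; lra.
  by rewrite hv /u; field; rewrite !gt_eqF //; lra.
move=> /andP[lo hi].
have E : v - u = u * v * (r - rho).
  by transitivity (v * (r * u) - u * (rho * v)); [rewrite ru rr|]; ring.
have uv0 : 0 <= u * v by rewrite mulr_ge0 // ltW.
have uv5 : u * v <= 1 / 5 by nra.
pose d := 48 / (M + 1).
have dM : d * (M + 1) = 48 by rewrite /d divfK // gt_eqF //; lra.
have fM : 48 / M <= 3 / 2 * d.
  by rewrite ler_pdivrMr; [nra|lra].
have d0 : 0 <= d by rewrite /d divr_ge0; lra.
have -> : (3 * u - 9) / (M + 1) = (3 * u - 9) / 48 * d.
  by rewrite /d; field; rewrite gt_eqF //; lra.
rewrite -/d E.
have {}hi : r - rho <= 3 / 2 * d by lra.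
have {}lo : - (3 / 2 * d) <= r - rho by lra.
have h1 : u * v * (r - rho) <= u * v * (3 / 2 * d) by rewrite ler_wpM2l.
have h2 : u * v * - (3 / 2 * d) <= u * v * (r - rho) by rewrite ler_wpM2l.
have h3 : u * v * d <= 1 / 5 * d by rewrite ler_wpM2r.
have h4 : u * d <= d by rewrite ler_piMl.
have h5 : 0 <= u * d by rewrite mulr_ge0 // ltW.
by apply/andP; split; lra.
Qed.

Lemma ratio_cvg : (fun n => s n / s n.+1) @ \oo --> 3 - 2 * Num.sqrt 2.
Proof.
have [r5 r6 rr] := rho_bounds.
have r0 : rho != 0 by rewrite gt_eqF //; lra.
have -> : 3 - 2 * Num.sqrt 2 = rho^-1.
  by apply: (@mulfI _ rho) => //; rewrite divff // -[RHS]rr; ring.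
rewrite (_ : (fun n => _) = (fun n => (s n.+1 / s n)^-1)); last first.
  by apply/funext => n; rewrite invf_div.
apply: cvgV => //.
apply/cvgrPdist_le => e e0; have e48 : 0 < e / 48 by rewrite divr_gt0.
near=> n.
rewrite distrC; apply: le_trans (ratio_dist_le _) _.
  by near: n; exists 1%N.
rewrite mulrC -ler_pdivlMr //; apply: ltW.
by near: n; exact: (near_infty_natSinv_lt (PosNum e48)).
Unshelve. all: by end_near.
Qed.

(** The quotient telescopes into [j] inverse ratios. *)
Lemma quotient_cvg j : (fun n => s n / s (n + j)%N) @ \oo --> (3 - 2 * Num.sqrt 2) ^+ j.
Proof.
elim: j => [|j IH].
  rewrite expr0; apply: cvg_near_cst; near=> n; rewrite addn0 divff // gt_eqF // s_gt0 //.
  by near: n; exists 1%N.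
rewrite exprSr.
have H : (fun n => s (n + j)%N / s (n + j)%N.+1) @ \oo --> 3 - 2 * Num.sqrt 2.
  by rewrite (cvg_shiftn j (fun n => s n / s n.+1)); exact: ratio_cvg.
apply: cvg_trans (cvgM IH H).
apply: near_eq_cvg; near=> n.
have n0 : (0 < n)%N by near: n; exists 1%N.
rewrite /= addnS; field.
by rewrite !gt_eqF // s_gt0 // ?addn_gt0 ?n0.
Unshelve. all: by end_near.
Qed.
End Ratio.

(** * Expectations *)

Lemma EsepE (R : realFieldType) n (X : 'S_n -> nat) :
  Esep (fun s => (X s)%:R : R) = (\sum_(s in Ssep n) X s)%N%:R / #|Ssep n|%:R.
Proof.
rewrite /Esep natr_sum big_distrl /= [RHS]big_mkcond /=; apply: eq_bigr => s _.
rewrite /Psep; have -> : #|([set s] :&: Ssep n)%SET| = (s \in Ssep n).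
  case: (boolP (s \in Ssep n)) => [sn|sn].
    by rewrite (finset.setIidPl _) ?cards1 // finset.sub1set.
  by apply/eqP; rewrite cards_eq0 setI_eq0 disjoints1.
by case: (s \in Ssep n); rewrite ?mul0r ?mulr0 ?mul1r.
Qed.

Section Density.
Variable R : realType.
Let s n : R := #|Ssep n|%:R.

Lemma Ssep_schroeder n : (2 <= n)%N -> s n = s n.-1 + \sum_(i < n.+1) s i * s (n - i)%N.
Proof.
move=> n2; rewrite /s (card_Ssep_rec n2) natrD natr_sum; congr (_ + _).
by apply: eq_bigr => i _; rewrite natrM.
Qed.

Lemma Ssep_le n : (0 < n)%N -> s n <= s n.+1.
Proof. by move=> n0; rewrite ler_nat [leqRHS]card_Ssep_rec // leq_addr. Qed.

Lemma Ssep_gt0 n : (0 < n)%N -> 0 < s n.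
Proof.
elim: n => // -[|n] IH _; first by rewrite /s card_Ssep1.
by apply: lt_le_trans (Ssep_le _); rewrite ?IH.
Qed.

Lemma Ssep_quotient_cvg j : (fun n => s n / s (n + j)%N) @ \oo --> (3 - 2 * Num.sqrt 2) ^+ j.
Proof.
apply: quotient_cvg; [exact: Ssep_gt0 | exact: Ssep_le | |].
  by rewrite Ssep_schroeder // /s !big_ord_recr big_ord0 /= card_Ssep0 card_Ssep1; ring.
apply: schroeder_three_term; [by rewrite /s card_Ssep0|by rewrite /s card_Ssep1|exact: Ssep_schroeder].
Qed.

Lemma cvg_shift_quotient j : (fun n => n%:R / (n + j)%N%:R : R) @ \oo --> (1 : R).
Proof.
case: j => [|j].
  apply: cvg_near_cst; near=> n; rewrite addn0 divff // pnatr_eq0 -lt0n.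
  by near: n; exists 1%N.
apply/cvgrPdist_le => e e0; have ej : 0 < e / j.+1%:R by rewrite divr_gt0.
near=> n.
have -> : 1 - n%:R / (n + j.+1)%:R = j.+1%:R / (n + j.+1)%:R :> R.
  have nj0 : (n + j.+1)%:R != 0 :> R by rewrite pnatr_eq0 addnS.
  by rewrite -[X in X - _](divff nj0) -mulrBl natrD addrC addKr.
rewrite ger0_norm ?divr_ge0 // mulrC -ler_pdivlMr //.
apply: (@le_trans _ _ n.+1%:R^-1); last first.
  by apply: ltW; near: n; exact: (near_infty_natSinv_lt (PosNum ej)).
by rewrite lef_pV2 ?posrE ?ltr0n ?ler_nat ?addnS // ltnS leq_addr.
Unshelve. all: by end_near.
Qed.

(** Written at n + (k - 1), the quotient X n / n is n / (n + (k - 1)), which tends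
    to 1, times s n / s (n + (k - 1)) times [c]. *)
Lemma block_density (k : nat) (X : nat -> R) (c : R) : (2 <= k)%N ->
  (forall n, (k <= n)%N -> X n = (n - k + 1)%N%:R * s (n - k + 1) * c / s n) ->
  (fun n => X n / n%:R) @ \oo --> (3 - 2 * Num.sqrt 2) ^+ (k - 1) * c.
Proof.
move=> k2 XE.
rewrite -(cvg_shiftn (k - 1)%N (fun n => X n / n%:R)).
have H : (fun n => n%:R / (n + (k - 1))%N%:R * (s n / s (n + (k - 1))%N * c)) @ \oo -->
    1 * ((3 - 2 * Num.sqrt 2) ^+ (k - 1) * c).
  apply: cvgM; first exact: cvg_shift_quotient.
  by apply: cvgM; [exact: Ssep_quotient_cvg | exact: cvg_cst].
rewrite mul1r in H; apply: cvg_trans H; apply: near_eq_cvg; near=> n.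
have n0 : (0 < n)%N by near: n; exists 1%N.
have kn : (k <= n + (k - 1))%N by lia.
rewrite /= XE //; have -> : (n + (k - 1) - k + 1 = n)%N by lia.
have nk0 : (0 < n + (k - 1))%N by lia.
by field; rewrite -natrD pnatr_eq0 -lt0n nk0 gt_eqF //; exact: Ssep_gt0.
Unshelve. all: by end_near.
Qed.
End Density.

Theorem corollary3 (R : realType) (k : nat) (hk : (2 <= k)%N) :
  (forall tau : 'S_k, tau \in Ssep k ->
     (forall n : nat, (k <= n)%N ->
        Esep (fun sigma : 'S_n => (Nblock_pattern tau sigma)%:R : R) =
        (n - k + 1)%N%:R * #|Ssep (n - k + 1)|%:R / #|Ssep n|%:R) /\
     (fun n : nat =>
        Esep (fun sigma : 'S_n => (Nblock_pattern tau sigma)%:R : R) / n%:R)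
       @ \oo --> (3 - 2 * Num.sqrt 2) ^+ (k - 1)) /\
  (forall n : nat, (k <= n)%N ->
     Esep (fun sigma : 'S_n => (Nblock k sigma)%:R : R) =
     (n - k + 1)%N%:R * #|Ssep (n - k + 1)|%:R * #|Ssep k|%:R / #|Ssep n|%:R) /\
  (fun n : nat =>
     Esep (fun sigma : 'S_n => (Nblock k sigma)%:R : R) / n%:R)
    @ \oo --> (3 - 2 * Num.sqrt 2) ^+ (k - 1) * #|Ssep k|%:R.
Proof.
have k0 : (0 < k)%N by exact: ltnW.
have pat (tau : 'S_k) : tau \in Ssep k -> forall n, (k <= n)%N ->
    Esep (fun sigma : 'S_n => (Nblock_pattern tau sigma)%:R : R) =
    (n - k + 1)%N%:R * #|Ssep (n - k + 1)|%:R / #|Ssep n|%:R.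
  move=> st n kn; rewrite EsepE addn1.
  by have := sum_Nblock_pattern (n - k) k0 st; rewrite subnK // => ->; rewrite natrM.
have total n : (k <= n)%N -> Esep (fun sigma : 'S_n => (Nblock k sigma)%:R : R) =
    (n - k + 1)%N%:R * #|Ssep (n - k + 1)|%:R * #|Ssep k|%:R / #|Ssep n|%:R.
  move=> kn; rewrite EsepE addn1.
  by have := sum_Nblock (n - k) k0; rewrite subnK // => ->; rewrite !natrM.
split; [move=> tau st; split; first exact: pat | split; first exact: total].
  rewrite -[X in _ --> X]mulr1; apply: block_density => // n kn.
  by rewrite mulr1 pat.
exact: block_density.
Qed.
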